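(* Let $n>1$. In $K_n$ we have $|S(f,n)|=|K_{n-1}|$.
   Context: For a natural number $k$, $[k]=\{1,\dots,k\}$, and $[0]=\emptyset$. For $n\ge1$, Kiselman's semigroup $K_n$ is the (finite) monoid, with unit element $e$, given by generators $a_1,\dots,a_n$ and relations $a_i^2=a_i$ for all $i\in[n]$, and $a_i a_j a_i = a_j a_i a_j = a_i a_j$ for all $1\le j<i\le n$. The element $f=a_na_{n-1}\cdots a_1$ is the zero element of $K_n$. For $X\subseteq[n]$, the deletion endomorphism $\overline{\partial}_X:K_n\to K_n$ is the unique monoid endomorphism with $\overline{\partial}_X(a_i)=a_i$ if $i\notin X$ and $\overline{\partial}_X(a_i)=e$ if $i\in X$. The ultrametric $d$ on $K_n$ is $d(x,y)=\min\{i\in\{0,1,\dots,n\}\mid \overline{\partial}_{[i]}(x)=\overline{\partial}_{[i]}(y)\}$, and $S(a,r)=\{x\in K_n\mid d(a,x)=r\}$. *)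

(* Defs.v *)
From HB Require Import structures.
From mathcomp Require Import all_boot.
From mathcomp Require Import boolp classical_sets functions cardinality.

Set Implicit Arguments.
Unset Strict Implicit.
Unset Printing Implicit Defensive.

Local Open Scope quotient_scope.
Local Open Scope group_scope.

(* Indices are shifted by one: [i : 'I_n] stands for the index [i.+1] in
   {1, ..., n}, so that [kgen i] is a_{i+1}. *)

Inductive kiselman_cong n : seq 'I_n -> seq 'I_n -> Prop :=
| KCrefl u : kiselman_cong u u
| KCsym u v : kiselman_cong u v -> kiselman_cong v u
| KCtrans v u w : kiselman_cong u v -> kiselman_cong v w -> kiselman_cong u w
| KCcat u u' v v' : kiselman_cong u u' -> kiselman_cong v v' ->
    kiselman_cong (u ++ v) (u' ++ v')
| KCidem (i : 'I_n) : kiselman_cong [:: i; i] [:: i]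
| KCiji (i j : 'I_n) : (j < i)%N -> kiselman_cong [:: i; j; i] [:: i; j]
| KCjij (i j : 'I_n) : (j < i)%N -> kiselman_cong [:: j; i; j] [:: i; j].

Definition kiselman_rel n : rel (seq 'I_n) := fun u v => `[< kiselman_cong u v >].

Lemma kiselman_rel_refl n : reflexive (@kiselman_rel n).
Proof. by move=> u; apply/asboolP; exact: KCrefl. Qed.

Lemma kiselman_rel_sym n : symmetric (@kiselman_rel n).
Proof. by move=> u v; apply/asboolP/asboolP; exact: KCsym. Qed.

Lemma kiselman_rel_trans n : transitive (@kiselman_rel n).
Proof.
by move=> v u w /asboolP uv /asboolP vw; apply/asboolP; exact: KCtrans uv vw.
Qed.

Canonical kiselman_equiv n :=
  EquivRel (@kiselman_rel n) (@kiselman_rel_refl n) (@kiselman_rel_sym n)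
           (@kiselman_rel_trans n).

Definition kiselman n := {eq_quot (kiselman_equiv n)}.

HB.instance Definition _ n := Choice.on (kiselman n).
HB.instance Definition _ n := EqQuotient.on (kiselman n).

Section KiselmanMonoid.
Variable n : nat.
Implicit Types (i j : 'I_n) (X : {set 'I_n}) (u v : seq 'I_n) (x y : kiselman n).

Lemma kiselman_eqP u v :
  reflect (kiselman_cong u v) (\pi_(kiselman n) u == \pi_(kiselman n) v).
Proof. by rewrite eqmodE; exact: asboolP. Qed.

Lemma kiselman_reprP u : kiselman_cong (repr (\pi_(kiselman n) u)) u.
Proof. by apply/kiselman_eqP; rewrite reprK. Qed.

Definition kmul x y : kiselman n := \pi_(kiselman n) (repr x ++ repr y).
Definition kone : kiselman n := \pi_(kiselman n) [::].

Lemma kmul_pi u v :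
  kmul (\pi_(kiselman n) u) (\pi_(kiselman n) v) = \pi_(kiselman n) (u ++ v).
Proof. by apply/eqP/kiselman_eqP/KCcat; exact: kiselman_reprP. Qed.

Lemma kmulA : associative kmul.
Proof.
move=> x y z; rewrite -[x]reprK -[y]reprK -[z]reprK.
rewrite (kmul_pi (repr y)) (kmul_pi (repr x) (repr y)).
by rewrite (kmul_pi (repr x)) (kmul_pi (_ ++ _)) catA.
Qed.

Lemma kmul1 : left_id kone kmul.
Proof. by move=> x; rewrite -[x]reprK (kmul_pi [::]). Qed.

Lemma kmulr1 : right_id kone kmul.
Proof. by move=> x; rewrite -[x]reprK (kmul_pi _ [::]) cats0. Qed.

HB.instance Definition _ := isMonoid.Build (kiselman n) kmulA kmul1 kmulr1.

Definition kgen (i : 'I_n) : kiselman n := \pi_(kiselman n) [:: i].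

Definition kf : kiselman n := \prod_(i <- rev (enum 'I_n)) kgen i.

Lemma pi_prod u : \pi_(kiselman n) u = \prod_(i <- u) kgen i.
Proof.
elim: u => [|i u IHu]; first by rewrite big_nil.
by rewrite big_cons -IHu; symmetry; exact: (kmul_pi [:: i] u).
Qed.

Lemma kgen_idem i : kgen i * kgen i = kgen i.
Proof.
rewrite [LHS](kmul_pi [:: i] [:: i]); apply/eqP/kiselman_eqP.
exact: KCidem.
Qed.

Lemma kgen_iji i j : (j < i)%N -> kgen i * kgen j * kgen i = kgen i * kgen j.
Proof.
move=> ji; have := pi_prod [:: i; j]; have := pi_prod [:: i; j; i].
rewrite !big_cons !big_nil !mulg1 mulgA => <- <-; apply/eqP/kiselman_eqP.
exact: KCiji.
Qed.

Lemma kgen_jij i j : (j < i)%N -> kgen j * kgen i * kgen j = kgen i * kgen j.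
Proof.
move=> ji; have := pi_prod [:: i; j]; have := pi_prod [:: j; i; j].
rewrite !big_cons !big_nil !mulg1 mulgA => <- <-; apply/eqP/kiselman_eqP.
exact: KCjij.
Qed.

Definition del_gen X i : kiselman n := if i \in X then 1 else kgen i.

Definition del X x : kiselman n := \prod_(i <- repr x) del_gen X i.

Lemma del_gen_cong X u v : kiselman_cong u v ->
  \prod_(i <- u) del_gen X i = \prod_(i <- v) del_gen X i.
Proof.
elim=> {u v} //.
- by move=> v u w _ -> _ ->.
- by move=> u u' v v' _ uu' _ vv'; rewrite !big_cat /= uu' vv'.
- move=> i; rewrite !big_cons !big_nil !mulg1 /del_gen.
  by case: ifP; rewrite ?mulg1 ?kgen_idem.
- move=> i j ji; rewrite !big_cons !big_nil !mulg1 /del_gen mulgA.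
  by do 2![case: ifP => _]; rewrite ?mulg1 ?mul1g ?kgen_idem ?kgen_iji.
- move=> i j ji; rewrite !big_cons !big_nil !mulg1 /del_gen mulgA.
  by do 2![case: ifP => _]; rewrite ?mulg1 ?mul1g ?kgen_idem ?kgen_jij.
Qed.

Lemma del_pi X u : del X (\pi_(kiselman n) u) = \prod_(i <- u) del_gen X i.
Proof. exact: del_gen_cong (kiselman_reprP u). Qed.

Lemma del_umagma X : {morph del X : x y / x * y} * (del X 1 = 1).
Proof.
split; last by rewrite [LHS]del_pi big_nil.
move=> x y; rewrite -[x]reprK -[y]reprK [X in del _ X]kmul_pi.
by rewrite !del_pi big_cat.
Qed.

HB.instance Definition _ X := isMultiplicative.Build _ _ (del X) (del_umagma X).1.
HB.instance Definition _ X :=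
  Multiplicative_isUMagmaMorphism.Build _ _ (del X) (del_umagma X).2.

Lemma del_kgen X i : del X (kgen i) = if i \in X then 1 else kgen i.
Proof. by rewrite del_pi big_cons big_nil mulg1. Qed.

Lemma del_unique X (phi : UMagmaMorphism.type (kiselman n) (kiselman n)) :
  (forall i, phi (kgen i) = if i \in X then 1 else kgen i) -> phi =1 del X.
Proof.
move=> phi_a x; rewrite -[x]reprK pi_prod.
elim: (repr x) => [|i u IHu]; first by rewrite big_nil !gmulf1.
by rewrite big_cons gmulfM phi_a IHu (del_umagma X).1 del_kgen.
Qed.

Definition initial (k : nat) : {set 'I_n} := [set i : 'I_n | (i < k)%N]%SET.

Definition agree_after x y (k : nat) : bool :=
  (k <= n)%N && (del (initial k) x == del (initial k) y).

Lemma agree_after_ex x y : exists k, agree_after x y k.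
Proof.
exists n; rewrite /agree_after leqnn /=.
suff del1 z : del (initial n) z = 1 by rewrite !del1.
by rewrite /del big1 // => i _; rewrite /del_gen inE ltn_ord.
Qed.

Definition dist x y : nat := ex_minn (agree_after_ex x y).

Definition sphere x (r : nat) : set (kiselman n) :=
  [set y | dist x y = r]%classic.

End KiselmanMonoid.

Arguments kf : clear implicits.

(* Main.v *)
Require Import Defs.
From mathcomp Require Import all_boot.
From mathcomp Require Import boolp classical_sets functions cardinality.

(** The set of generators occurring in a word is invariant under the Kiselman
    congruence, and deleting a_1, ..., a_{n-1} from f leaves a_n.  Hence x is at
    distance n from f iff a_n does not occur in x, i.e. iff x lies in the
    submonoid generated by a_1, ..., a_{n-1}.  This submonoid is a copy of
    K_{n-1}, because K_{n-1} -> K_n has the deletion of a_n as a retraction. *)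

Local Open Scope classical_set_scope.
Local Open Scope card_scope.

Lemma kiselman_cong_mem (n : nat) (u v : seq 'I_n) :
  kiselman_cong u v -> u =i v.
Proof.
elim=> {u v} //.
- by move=> u v _ uv i; rewrite uv.
- by move=> v u w _ uv _ vw i; rewrite uv vw.
- by move=> u u' v v' _ uu' _ vv' i; rewrite !mem_cat uu' vv'.
- by move=> i k; rewrite !inE orbb.
- by move=> i j _ k; rewrite !inE; do 2!case: (k == _).
- by move=> i j _ k; rewrite !inE; do 2!case: (k == _).
Qed.

(** Order-preserving renaming and erasure of generators are treated at once. A relation with both
    letters kept becomes one of the same kind; with a letter erased, it collapses to idempotence or
    to a trivial identity. *)
Lemma kiselman_cong_pmap (n m : nat) (f : 'I_n -> option 'I_m)
    (f_mono : forall i j i' j', f i = Some i' -> f j = Some j' ->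
       (j < i)%N -> (j' < i')%N) (u v : seq 'I_n) :
  kiselman_cong u v -> kiselman_cong (pmap f u) (pmap f v).
Proof.
elim=> {u v}.
- by move=> u; apply: KCrefl.
- by move=> u v _; apply: KCsym.
- by move=> v u w _ uv _; apply: KCtrans.
- by move=> u u' v v' _ uu' _ vv'; rewrite !pmap_cat; apply: KCcat.
- by move=> i /=; case: (f i) => [i'|] /=; [apply: KCidem | apply: KCrefl].
- move=> i j ji /=; case fi: (f i) => [i'|]; case fj: (f j) => [j'|] /=.
  + exact/KCiji/(f_mono _ _ _ _ fi fj).
  + exact: KCidem.
  + exact: KCrefl.
  + exact: KCrefl.
- move=> i j ji /=; case fi: (f i) => [i'|]; case fj: (f j) => [j'|] /=.
  + exact/KCjij/(f_mono _ _ _ _ fi fj).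
  + exact: KCrefl.
  + exact: KCidem.
  + exact: KCrefl.
Qed.

Lemma kiselman_cong_lift (m : nat) (u v : seq 'I_m) :
  kiselman_cong (map (lift ord_max) u) (map (lift ord_max) v) <->
  kiselman_cong u v.
Proof.
split=> [uv|].
  (* Cancellation by the retraction: [pmap (unlift ord_max)] erases the top letter and undoes
     [lift ord_max]. *)
  rewrite -(map_pK (@liftK _ ord_max) u) -(map_pK (@liftK _ ord_max) v).
  apply: kiselman_cong_pmap uv => i j i' j'.
  case: unliftP => [k ->|//] [<-]; case: unliftP => [l ->|//] [<-].
  by rewrite !lift_max.
have pmapE w : map (lift ord_max) w = pmap (Some \o lift ord_max) w.
  by elim: w => //= i w ->.
rewrite !pmapE; apply: kiselman_cong_pmap => i j _ _ [<-] [<-].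
by rewrite !lift_max.
Qed.

Lemma del_pi_filter (n : nat) (X : {set 'I_n}) (u : seq 'I_n) :
  del X (\pi_(kiselman n)%qT u) = \pi_(kiselman n)%qT [seq i <- u | i \notin X].
Proof.
rewrite del_pi pi_prod big_filter [RHS]big_mkcond; apply: eq_bigr => i _.
by rewrite /del_gen; case: ifP.
Qed.

Lemma kiselman_cong_nseq (n : nat) (a : 'I_n) (u : seq 'I_n) :
  a \in u -> all (pred1 a) u -> kiselman_cong u [:: a].
Proof.
move=> au /all_pred1P u_a; move: au; rewrite u_a.
elim: (size u) => // -[_ _|k IHk _]; first exact: KCrefl.
have aa : a \in nseq k.+1 a by rewrite mem_head.
apply: KCtrans (KCidem a).
exact: (KCcat (KCrefl [:: a]) (IHk aa)).
Qed.

Lemma dist_kf_max (m : nat) (u : seq 'I_m.+1) :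
  dist (kf m.+1) (\pi_(kiselman m.+1)%qT u) = m.+1 <-> ord_max \notin u.
Proof.
have kfE : kf m.+1 = \pi_(kiselman m.+1)%qT (rev (enum 'I_m.+1)).
  by rewrite pi_prod.
have max_kf : ord_max \in rev (enum 'I_m.+1) by rewrite mem_rev mem_enum.
rewrite /dist; case: ex_minnP => k /andP[k_le agree] k_min; split=> [k_eq|].
  (* If a_n occurs in [u], deleting the first [m] generators leaves a nonempty power of a_n from
     both words, so the distance is at most [m]. *)
  apply/negP => u_max; suff /k_min : agree_after (kf m.+1) (\pi_(kiselman m.+1)%qT u) m.
    by rewrite k_eq ltnn.
  rewrite /agree_after leqnSn /= kfE !del_pi_filter; apply/kiselman_eqP.
  have to_max w : ord_max \in w ->
      kiselman_cong [seq i <- w | i \notin initial m.+1 m] [:: ord_max].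
    move=> w_max; apply: kiselman_cong_nseq.
      by rewrite mem_filter inE ltnn.
    rewrite all_filter; apply/allP => i _ /=; apply/implyP.
    rewrite inE -leqNgt => m_le.
    by apply/eqP/val_inj/eqP; rewrite eqn_leq m_le -ltnS ltn_ord.
  exact: KCtrans (to_max _ max_kf) (KCsym (to_max _ u_max)).
(* For [k] at most [m], the letter a_n survives the deletion of [initial k], so its occurrence in f
   passes to [u]. *)
apply: contraNeq => k_neq; have k_lt : (k < m.+1)%N by rewrite ltn_neqAle k_neq.
move: agree; rewrite kfE !del_pi_filter => /kiselman_eqP/kiselman_cong_mem/(_ ord_max).
by rewrite !mem_filter inE -leqNgt -ltnS k_lt max_kf /= => <-.
Qed.

Theorem corollary7p5 (n : nat) (hn : (1 < n)%N) :
  sphere (kf n) n #= [set: kiselman n.-1].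
Proof.
case: n hn => // m _ /=.
pose up (x : kiselman m) : kiselman m.+1 :=
  \pi_(kiselman m.+1)%qT (map (lift ord_max) (repr x)).
have up_inj : injective up.
  move=> x y /eqP/kiselman_eqP/kiselman_cong_lift/kiselman_eqP/eqP.
  by rewrite !reprK.
(* An injection with image the sphere gives equality of cardinals, with no counting of elements. *)
suff -> : sphere (kf m.+1) m.+1 = range up.
  by apply: inj_card_eq => x y _ _; apply: up_inj.
apply/seteqP; split=> [y|_ [x _ <-]] /=; last first.
  by apply/dist_kf_max/mapP => -[i _ /eqP]; rewrite (negPf (neq_lift _ _)).
rewrite -[y]reprK => /dist_kf_max y_max.
exists (\pi_(kiselman m)%qT (pmap (unlift ord_max) (repr y))) => //.
apply/eqP/kiselman_eqP.
(* Only the right-hand word is rewritten: as a_n does not occur in it, [unlift] erases nothing and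
   [lift] restores every letter. *)
have {2}-> : repr y = map (lift ord_max) (pmap (unlift ord_max) (repr y)).
  elim: (repr y) y_max => //= i w IHw; rewrite inE negb_or => /andP[i_max w_max].
  by case: unliftP i_max => [j ->|->] /=; rewrite ?eqxx // -IHw.
exact/kiselman_cong_lift/kiselman_reprP.
Qed.
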